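(* Let $K$ be a field and let $a_1\ge a_2\ge\dots\ge a_m$ be a non-increasing sequence of non-negative integers ($m\ge1$). Then there exist an integer $n$ and a squarefree monomial ideal $I\subset S=K[x_1,\dots,x_n]$ (such that every variable $x_i$ divides some minimal monomial generator of $I$) with $\nu(I)=m$ and $g_I(k)=a_k$ for $k=1,\dots,m$.
   Context: For a squarefree monomial ideal $I\subset S$ (nonzero, proper), the $k$th squarefree power $I^{[k]}$ is the monomial ideal of $S$ generated by the squarefree monomials belonging to $I^k$. The monomial grade $\nu(I)$ is the biggest length of a monomial regular sequence contained in $I$; equivalently $I^{[k]}\neq(0)$ if and only if $k\le\nu(I)$. For $1\le k\le \nu(I)$, $d_k=\mathrm{indeg}(I^{[k]})$ is the minimum degree of a monomial generator of $I^{[k]}$, and the normalized depth function of $I$ is $g_I(k)=\mathrm{depth}(S/I^{[k]})-(d_k-1)$ for $1\le k\le\nu(I)$ (this is always a non-negative integer). By convention $S$ is always the smallest polynomial ring over $K$ containing the minimal monomial generators of $I$, i.e. every variable of $S$ divides some minimal generator of $I$. *)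

(* Defs.v *)
From mathcomp Require Export all_boot all_order all_algebra.
From mathcomp Require Export mpoly.

Set Implicit Arguments.
Unset Strict Implicit.
Unset Printing Implicit Defensive.

Import GRing.Theory.
Local Open Scope ring_scope.

Definition is_max (P : nat -> Prop) (d : nat) : Prop :=
  P d /\ forall e, P e -> (e <= d)%N.

(* Ideals are Prop-valued predicates, since membership in an ideal given by an
   arbitrary set of generators is not a priori boolean. *)

Definition ideal_gen (R : comNzRingType) (G : R -> Prop) : R -> Prop :=
  fun f => exists (r : nat) (c g : 'I_r -> R),
    (forall i, G (g i)) /\ f = \sum_(i < r) c i * g i.

Definition ideal_pow (R : comNzRingType) (I : R -> Prop) (k : nat) : R -> Prop :=
  ideal_gen (fun f => exists g : 'I_k -> R,
    (forall i, I (g i)) /\ f = \prod_(i < k) g i).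

(* [s] is a regular sequence on R/J: s`_i is a nonzerodivisor on
   R/(J, s`_0, ..., s`_(i-1)) for all i, and R/(J, s) is nonzero. *)
Definition regular_seq (R : comNzRingType) (J : R -> Prop) (s : seq R) : Prop :=
  let J_ i := ideal_gen (fun f => J f \/ f \in take i s) in
  (forall i, (i < size s)%N -> forall f, J_ i (s`_i * f) -> J_ i f)
  /\ ~ J_ (size s) 1.

Section Monomial.

Variables (K : fieldType) (n : nat).
Local Notation S := {mpoly K[n]}.
Implicit Types (I J : S -> Prop) (u v : 'X_{1..n}).

Definition max_ideal : S -> Prop :=
  ideal_gen (fun f => exists i : 'I_n, f = 'X_i).

(* d = depth(S/J), the largest length of a regular sequence on S/J contained
   in (x_1, ..., x_n). *)
Definition is_depth J (d : nat) : Prop :=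
  is_max (fun r => exists s : seq S,
    [/\ size s = r, (forall f, f \in s -> max_ideal f) & regular_seq J s]) d.

Definition squarefree u : Prop := forall i, (u i <= 1)%N.

Definition squarefree_monomial_ideal I : Prop :=
  exists G : 'X_{1..n} -> Prop,
    (forall u, G u -> squarefree u) /\
    (forall f, I f <-> ideal_gen (fun g => exists2 u, G u & g = 'X_[u]) f).

Definition nonzero_proper I : Prop :=
  (exists2 f, I f & f <> 0) /\ ~ I 1.

(* u belongs to the minimal monomial generating set of the monomial ideal J. *)
Definition min_gen J u : Prop :=
  J 'X_[u] /\ forall v, J 'X_[v] -> (v <= u)%MM -> v = u.

(* S is the smallest polynomial ring containing the minimal generators. *)
Definition all_vars_used I : Prop :=
  forall i : 'I_n, exists2 u, min_gen I u & (0 < u i)%N.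

Definition squarefree_power I (k : nat) : S -> Prop :=
  ideal_gen (fun f => exists u,
    [/\ squarefree u, ideal_pow I k 'X_[u] & f = 'X_[u]]).

(* d = nu(I) *)
Definition is_monomial_grade I (d : nat) : Prop :=
  is_max (fun r => exists s : seq 'X_{1..n},
    [/\ size s = r, (forall u, u \in s -> I 'X_[u])
      & regular_seq (fun f : S => f = 0) [seq 'X_[u] | u <- s]]) d.

(* d = indeg(J) *)
Definition is_indeg J (d : nat) : Prop :=
  (exists2 u, min_gen J u & mdeg u = d) /\
  (forall u, min_gen J u -> (d <= mdeg u)%N).

(* g = g_I(k) *)
Definition is_normalized_depth I (k : nat) (g : int) : Prop :=
  exists e d : nat,
    [/\ is_depth (squarefree_power I k) e,
        is_indeg (squarefree_power I k) d
      & g = e%:Z - (d%:Z - 1)].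

End Monomial.

(* Main.v *)
Require Import Defs.
From mathcomp Require Import zify ring.

Set Implicit Arguments.
Unset Strict Implicit.
Unset Printing Implicit Defensive.

Import GRing.Theory.
Local Open Scope ring_scope.

(** The ideal.  Let b be large, put q_i = b - a_(i+1) for i < m, and take
    n = q_0 + ... + q_(m-1) + (b - 1) variables, of which q_i form a block W_i
    and b - 1 are left over.  Let I be generated by the m block monomials
    x_(W_i) and by all squarefree monomials of degree b.  A squarefree monomial
    x_F lies in I^[k] exactly when F contains k pairwise disjoint generators
    (squarefree_powerP).  Since q_0 <= ... <= q_(m-1) <= b, such an F has at
    least q_0 + ... + q_(k-1) elements, which gives the initial degree d_k, and
    since only b - 1 variables lie outside the blocks there are never m + 1
    disjoint generators, which gives nu(I) = m: a regular sequence of monomials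
    has pairwise disjoint supports.

    The depth.  The claim is depth S/I^[k] = r_k with
    r_k = q_0 + ... + q_(k-2) + b - 1, so that g_I(k) = r_k - d_k + 1
    = b - q_(k-1) = a_k.  The complex of the sets F with x_F outside I^[k] has
    a facet of size r_k, namely the first k - 1 blocks together with the
    leftover variables.  This forces depth <= r_k by depth_le_facet, which is
    the inequality depth M <= dim R/P for the associated prime P of the facet:
    if more than |F| elements formed a regular sequence, so would high powers
    of them; these powers are algebraically dependent modulo P, and a nontrivial
    constant relation that kills x_F puts x_F into the ideal of those powers,
    hence into I^[k] plus a high power of the maximal ideal, which is absurd.

    For depth >= r_k a single explicit sequence serves, so that no choice of
    generic elements is needed and K may be finite: the elementary symmetric
    polynomials e_1, ..., e_r of all the variables are regular on every
    quotient S/P by variables of dimension at least r (elementary_regular).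
    Being regular for a fixed sequence passes from S/(J : x) and S/(J + x) to
    S/J (wregular_extension), so it is enough to reach quotients by variables
    of dimension >= r_k by repeatedly taking the link or the deletion of a
    vertex.  Deciding first, block by block, whether the block is contained in
    the link part or meets the deleted part costs at most m deletions; after
    that, unless nothing is left, every set of at most r_k remaining variables
    is a face, so the order of the other decisions does not matter
    (good_undecided, nonmatching_regular). *)

(** * Ideals as predicates and regular sequences *)

Section WeakRegularity.
Variable R : comNzRingType.
Implicit Types (J A C : R -> Prop) (s : seq R).

Definition is_ideal J :=
  [/\ J 0, forall x y, J x -> J y -> J (x + y) & forall c x, J x -> J (c * x)].

(** The ideal J + (f); for an ideal J one multiple of f is enough. *)
Definition add_ideal J f : R -> Prop := fun h => exists c, J (h - c * f).

Definition add_seq J s := foldl add_ideal J s.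

(** Regularity on R/J without the requirement that the final quotient be
    nonzero.  Dropping that requirement makes the notion stable under
    extensions, even when one of the outer terms vanishes. *)
Fixpoint wregular J s : Prop :=
  if s is f :: s' then
    (forall h, J (f * h) -> J h) /\ wregular (add_ideal J f) s'
  else True.

Lemma ideal0 J : is_ideal J -> J 0. Proof. by case. Qed.
Lemma idealD J x y : is_ideal J -> J x -> J y -> J (x + y).
Proof. by case=> _ h _; apply: h. Qed.
Lemma idealMl J c x : is_ideal J -> J x -> J (c * x).
Proof. by case=> _ _; apply. Qed.
Lemma idealB J x y : is_ideal J -> J x -> J y -> J (x - y).
Proof.
by move=> iJ hx hy; apply: idealD => //; rewrite -mulN1r; apply: idealMl.
Qed.
Lemma ideal_sum J (T : Type) (r : seq T) (P : pred T) (F : T -> R) :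
  is_ideal J -> (forall i, P i -> J (F i)) -> J (\sum_(i <- r | P i) F i).
Proof.
move=> iJ hF; apply: (big_ind J); [exact: ideal0 | | exact: hF].
by move=> x y; apply: idealD.
Qed.

Lemma add_ideal_is_ideal J f : is_ideal J -> is_ideal (add_ideal J f).
Proof.
move=> iJ; split.
- by exists 0; rewrite mul0r subr0; apply: ideal0.
- move=> x y [c hc] [d hd]; exists (c + d).
  by rewrite mulrDl opprD addrACA; apply: idealD.
- move=> c x [d hd]; exists (c * d).
  by rewrite -mulrA -mulrBr; apply: idealMl.
Qed.

Lemma add_seq_is_ideal J s : is_ideal J -> is_ideal (add_seq J s).
Proof. by elim: s J => //= f s IH J iJ; apply/IH/add_ideal_is_ideal. Qed.

Lemma add_idealS J f h : J h -> add_ideal J f h.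
Proof. by move=> hh; exists 0; rewrite mul0r subr0. Qed.

Lemma add_seqS J s h : J h -> add_seq J s h.
Proof. by elim: s J => //= f s IH J hh; apply/IH/add_idealS. Qed.

Lemma add_ideal_gen J f : is_ideal J -> add_ideal J f f.
Proof. by move=> iJ; exists 1; rewrite mul1r subrr; apply: ideal0. Qed.

Lemma add_ideal_min J C f h :
  is_ideal C -> (forall x, J x -> C x) -> C f -> add_ideal J f h -> C h.
Proof.
move=> iC sJC hf [c hc]; rewrite -(subrK (c * f) h).
by apply: idealD => //; [apply: sJC | apply: idealMl].
Qed.

Lemma add_seq_min J C s h : is_ideal C -> (forall x, J x -> C x) ->
  (forall f, f \in s -> C f) -> add_seq J s h -> C h.
Proof.
move=> iC; elim: s J h => [|f s IH] J h sJC sC /=; first exact: sJC.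
apply: IH => [x|g gs]; last by apply: sC; rewrite inE gs orbT.
by apply: add_ideal_min => //; apply: sC; rewrite inE eqxx.
Qed.

Lemma add_seq_mem J s f : is_ideal J -> f \in s -> add_seq J s f.
Proof.
elim: s J => //= g s IH J iJ; rewrite inE => /predU1P[->|fs].
  by apply/add_seqS/add_ideal_gen.
by apply: IH => //; apply: add_ideal_is_ideal.
Qed.

Lemma wregular_ext J J' s : (forall h, J h <-> J' h) ->
  wregular J s -> wregular J' s.
Proof.
elim: s J J' => //= f s IH J J' e [h1 h2]; split.
  by move=> h /e/h1/e.
by apply: IH h2 => h; split=> -[c hc]; exists c; apply/e.
Qed.

Lemma wregular_cat J s1 s2 :
  wregular J (s1 ++ s2) <-> wregular J s1 /\ wregular (add_seq J s1) s2.
Proof.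
elim: s1 J => [|f s IH] J /=; first by split=> [|[]].
by split=> [[? /IH[]]|[[? ?] ?]]; do ?split=> //; apply/IH.
Qed.

(** The exact sequence 0 -> R/(J : x) -> R/J -> R/(J + x) -> 0: a sequence that
    is regular on both outer terms is regular on the middle one.  The sequence
    stays exact modulo f, because f is a nonzerodivisor on the right-hand term,
    and this is what the induction uses. *)
Lemma wregular_extension J A C x s : is_ideal J -> is_ideal A -> is_ideal C ->
    (forall h, J (x * h) <-> A h) -> (forall h, C h <-> add_ideal J x h) ->
  wregular A s -> wregular C s -> wregular J s.
Proof.
elim: s J A C => //= f s IH J A C iJ iA iC eA eC [rA hA] [rC hC]; split.
  move=> h fh.
  have /rC/eC[c hc] : C (f * h) by apply/eC/add_idealS.
  have : J (x * (f * c)).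
    have -> : x * (f * c) = f * h - f * (h - c * x) by ring.
    by apply: idealB => //; apply: idealMl.
  move/eA/rA/eA => xc; rewrite -(subrK (c * x) h) (mulrC c).
  by apply: idealD => //; rewrite (mulrC x).
apply: (IH _ (add_ideal A f) (add_ideal C f)) => //.
- exact: add_ideal_is_ideal.
- exact: add_ideal_is_ideal.
- exact: add_ideal_is_ideal.
- move=> h; split=> [[g hg]|[g hg]]; last first.
    exists (x * g); rewrite -mulrA -mulrBr; exact/eA.
  have /rC/eC[c hc] : C (f * g).
    apply/eC; exists h.
    have -> : f * g - h * x = - 1 * (x * h - g * f) by ring.
    exact: idealMl.
  exists c; apply/eA.
  have -> : x * (h - c * f) = (x * h - g * f) + f * (g - c * x) by ring.
  by apply: idealD => //; apply: idealMl.
- move=> h; split=> [[c /eC[d hd]]|[c [d hd]]].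
    by exists d; exists c; rewrite addrAC.
  by exists d; apply/eC; exists c; rewrite addrAC.
Qed.

(** R/(J + f^(N+2)) is an extension of R/(J + f) by R/(J + f^(N+1)) via
    multiplication by f. *)
Lemma wregular_expS J f s N : is_ideal J ->
  wregular J (f :: s) -> wregular J (f ^+ N.+1 :: s).
Proof.
move=> iJ [rf rs]; split=> [h|].
  elim: (N) h => [|k IH] h; first by rewrite expr1; apply: rf.
  by rewrite exprS -mulrA => /rf/IH.
elim: N => [|N IH]; first by apply: wregular_ext rs => h; rewrite expr1.
apply: (wregular_extension (x := f)) IH rs; try exact: add_ideal_is_ideal.
- move=> h; split=> [[c hc]|[c hc]]; exists c; last first.
    have -> : f * h - c * f ^+ N.+2 = f * (h - c * f ^+ N.+1).
      by rewrite (exprS f N.+1); ring.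
    exact: idealMl.
  by apply: rf; move: hc; rewrite (exprS f N.+1) mulrBr mulrCA.
- move=> h; split; first by case=> c hc; exists c; apply: add_idealS.
  case=> c [d hd]; exists (d * f ^+ N.+1 + c).
  have -> // : h - (d * f ^+ N.+1 + c) * f = h - c * f - d * f ^+ N.+2.
  by rewrite (exprSr f N.+1); ring.
Qed.

Lemma wregular_map_exp J s N : is_ideal J ->
  wregular J s -> wregular J [seq f ^+ N.+1 | f <- s].
Proof.
elim: s J => // f s IH J iJ rs.
have [rf {}rs] := wregular_expS N iJ rs.
by split=> //; apply: IH => //; apply: add_ideal_is_ideal.
Qed.

Lemma ideal_gen_is_ideal (G : R -> Prop) : is_ideal (ideal_gen G).
Proof.
split.
- by exists 0%N, (fun=> 0), (fun=> 0); split=> [[]//|]; rewrite big_ord0.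
- move=> x y [r1 [c1 [g1 [h1 ->]]]] [r2 [c2 [g2 [h2 ->]]]].
  exists (r1 + r2)%N.
  exists (fun i => match split i with inl j => c1 j | inr j => c2 j end).
  exists (fun i => match split i with inl j => g1 j | inr j => g2 j end).
  split; first by move=> i; case: (split i).
  rewrite big_split_ord /=; congr (_ + _); apply: eq_bigr => i _.
    by rewrite (unsplitK (inl i)).
  by rewrite (unsplitK (inr i)).
- move=> c x [r [d [g [h ->]]]]; exists r, (fun i => c * d i), g; split=> //.
  by rewrite mulr_sumr; apply: eq_bigr => i _; rewrite mulrA.
Qed.

Lemma ideal_gen_sub (G : R -> Prop) f : G f -> ideal_gen G f.
Proof.
move=> Gf; exists 1%N, (fun=> 1), (fun=> f); split=> //.
by rewrite big_ord1 mul1r.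
Qed.

Lemma ideal_gen_min (G C : R -> Prop) f :
  is_ideal C -> (forall g, G g -> C g) -> ideal_gen G f -> C f.
Proof.
move=> iC sGC [r [c [g [h ->]]]]; apply: ideal_sum => // i _.
by apply: idealMl => //; apply: sGC.
Qed.

Lemma ideal_gen_add_seq J s h : is_ideal J ->
  ideal_gen (fun f => J f \/ f \in s) h <-> add_seq J s h.
Proof.
move=> iJ; split.
  apply: ideal_gen_min; first exact: add_seq_is_ideal.
  by move=> g [/add_seqS//|]; apply: add_seq_mem.
apply: add_seq_min; first exact: ideal_gen_is_ideal.
  by move=> x hx; apply: ideal_gen_sub; left.
by move=> f fs; apply: ideal_gen_sub; right.
Qed.

(** The recursive definition of regularity agrees with the one by prefixes. *)
Lemma wregular_nth J s : wregular J s <->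
  forall i, (i < size s)%N -> forall f,
    add_seq J (take i s) (s`_i * f) -> add_seq J (take i s) f.
Proof.
elim: s J => [|g s IH] J /=; first by split.
split=> [[h1 /IH h2]|h].
  by case=> [_|i /h2] //=.
split; first by have := h 0%N isT.
by apply/IH => i; apply: (h i.+1).
Qed.

Lemma regular_seqP J s : is_ideal J ->
  regular_seq J s <-> wregular J s /\ ~ add_seq J s 1.
Proof.
move=> iJ; rewrite /regular_seq take_size; split=> -[h1 h2]; split.
- apply/wregular_nth => i his f /(ideal_gen_add_seq _ _ iJ)/(h1 i his).
  by move/(ideal_gen_add_seq _ _ iJ).
- by move=> h; apply: h2; apply/ideal_gen_add_seq.
- move=> i his f /(ideal_gen_add_seq _ _ iJ).
  by move/((wregular_nth _ _).1 h1 i his)/(ideal_gen_add_seq _ _ iJ).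
- by move/(ideal_gen_add_seq _ _ iJ).
Qed.

End WeakRegularity.

(** * Monomial ideals and simplicial complexes *)

Section MonomialIdeals.
Variables (K : fieldType) (n : nat).
Local Notation S := {mpoly K[n]}.
Implicit Types (J C : S -> Prop) (u v w : 'X_{1..n}) (A B D F T : {set 'I_n}).
Implicit Types (Q : 'X_{1..n} -> Prop).

(** The span of the monomials satisfying Q: a monomial ideal as soon as Q is
    closed under multiples. *)
Definition monomial_ideal Q : S -> Prop :=
  fun f => forall u, u \in msupp f -> Q u.

Definition supp u : {set 'I_n} := [set i | (0 < u i)%N].

(** The Stanley-Reisner ideal of the complex face. *)
Definition nonface_ideal (face : {set 'I_n} -> bool) : S -> Prop :=
  monomial_ideal (fun u => ~~ face (supp u)).

Lemma monomial_ideal_is_ideal Q :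
  (forall u v, Q u -> Q (u + v)%MM) -> is_ideal (monomial_ideal Q).
Proof.
move=> hQ; split.
- by move=> u; rewrite msupp0.
- by move=> f g hf hg u /msuppD_le; rewrite mem_cat => /orP[/hf|/hg].
- move=> c f hf u /msuppM_le/allpairsP[[u1 u2] /= [_ h ->]].
  by rewrite addmC; apply/hQ/hf.
Qed.

Lemma monomial_ideal_sub C Q : is_ideal C -> (forall u, Q u -> C 'X_[u]) ->
  forall f, monomial_ideal Q f -> C f.
Proof.
move=> iC hC f hf; rewrite (mpolyE f) big_seq; apply: ideal_sum => // u /hf/hC.
by move=> h; rewrite -mul_mpolyC; apply: idealMl.
Qed.

Lemma monomial_idealX Q u : monomial_ideal Q 'X_[u] <-> Q u.
Proof.
by split=> [|hu v]; [apply; rewrite msuppX inE | rewrite msuppX inE => /eqP->].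
Qed.

Lemma monomial_idealXM Q v f :
  monomial_ideal Q ('X_[v] * f) <-> monomial_ideal (fun u => Q (v + u)%MM) f.
Proof.
rewrite mulrC; split=> h u.
  move=> uf; apply: h; rewrite mcoeff_msupp mcoeffMX.
  by rewrite -mcoeff_msupp.
move/msuppM_le/allpairsP=> [[u1 u2] /= [hu1]].
by rewrite msuppX inE => /eqP-> ->; rewrite addmC; apply: h.
Qed.

Lemma ideal_gen_monomials (G : 'X_{1..n} -> Prop) f :
  ideal_gen (fun g => exists2 v, G v & g = 'X_[v]) f <->
  monomial_ideal (fun u => exists2 v, G v & (v <= u)%MM) f.
Proof.
split.
  apply: ideal_gen_min.
    apply: monomial_ideal_is_ideal => u v [w hw le_wu]; exists w => //.
    exact/(lepm_trans le_wu)/lem_addr.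
  move=> g [v hv ->]; apply/monomial_idealX; exists v => //.
  exact: lepm_refl.
move: f; apply: monomial_ideal_sub (ideal_gen_is_ideal _) _.
move=> u [v hv le_vu]; rewrite -(submK le_vu) mpolyXD.
apply: idealMl; first exact: ideal_gen_is_ideal.
by apply: ideal_gen_sub; exists v.
Qed.

Lemma supp0 : supp 0%MM = set0.
Proof. by apply/setP=> i; rewrite !inE mnm0E. Qed.

Lemma suppD u v : supp (u + v) = supp u :|: supp v.
Proof. by apply/setP=> i; rewrite !inE mnmDE addn_gt0. Qed.

Lemma suppU i : supp U_(i) = [set i].
Proof. by apply/setP=> j; rewrite !inE mnm1E eq_sym; case: eqP. Qed.

Lemma supp_mesym1 A : supp (mesym1 A) = A.
Proof. by apply/setP=> i; rewrite !inE mnmE; case: (i \in A). Qed.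

Lemma suppS u v : (u <= v)%MM -> supp u \subset supp v.
Proof.
move/mnm_lepP => h; apply/subsetP=> i; rewrite !inE => hi.
exact: leq_trans (h i).
Qed.

Lemma mesym1_le A u : (mesym1 A <= u)%MM = (A \subset supp u).
Proof.
apply/mnm_lepP/subsetP=> h i.
  by move=> iA; have := h i; rewrite mnmE iA inE.
rewrite mnmE; case: (boolP (i \in A)) => //= /h; by rewrite inE.
Qed.

Lemma card_supp u : (#|supp u| <= mdeg u)%N.
Proof.
rewrite -mdeg_mesym1 !mdegE; apply: leq_sum => i _.
by rewrite mnmE inE; case: (u i).
Qed.

Definition down_closed (face : {set 'I_n} -> bool) :=
  forall A B, A \subset B -> face B -> face A.

Lemma nonface_ideal_is_ideal face :
  down_closed face -> is_ideal (nonface_ideal face).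
Proof.
move=> hf; apply: monomial_ideal_is_ideal => u v; apply: contra; apply: hf.
by rewrite suppD subsetUl.
Qed.

End MonomialIdeals.

(** * A regular sequence common to all quotients by variables *)

Section LowerBound.
Variables (K : fieldType) (n : nat).
Local Notation S := {mpoly K[n]}.
Implicit Types (J C : S -> Prop) (u v w : 'X_{1..n}) (A B D F T : {set 'I_n}).
Implicit Types (face : {set 'I_n} -> bool).

Lemma disjoint_setU1 x A B :
  [disjoint x |: A & B] = (x \notin B) && [disjoint A & B].
Proof. by rewrite !disjoints_subset subUset sub1set inE. Qed.

Lemma card_setC_setU1 x D : x \notin D -> #|~: D| = #|~: (x |: D)|.+1.
Proof.
move=> xD; rewrite (cardsD1 x (~: D)) inE xD add1n; congr _.+1.
by congr #|pred_of_set _|; apply/setP=> z; rewrite !inE negb_or.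
Qed.

(** The cone with apex set T over the complex obtained by taking the link of T
    and deleting D.  Keeping the vertices of T as cone points makes colon ideals
    and sums with variables remain in the same polynomial ring. *)
Definition minor face T D F := [disjoint F & D] && face (F :|: T).

Lemma minor_down_closed face T D :
  down_closed face -> down_closed (minor face T D).
Proof.
move=> dc A B sAB /andP[hD hB]; apply/andP; split.
  exact: disjointWl hD.
by apply: dc hB; apply: setSU.
Qed.

Lemma nonface_colon face T D x f : x \notin D ->
  nonface_ideal (minor face T D) ('X_x * f) <->
  nonface_ideal (K := K) (minor face (x |: T) D) f.
Proof.
move=> xD; rewrite /nonface_ideal monomial_idealXM.
have e u : minor face T D (supp (U_(x) + u)) = minor face (x |: T) D (supp u).
  rewrite /minor suppD suppU disjoint_setU1 xD /=.
  by rewrite -setUA setUCA.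
by split=> h u /h; rewrite e.
Qed.

Lemma nonface_add face T D x f : down_closed face ->
  nonface_ideal (K := K) (minor face T (x |: D)) f <->
  add_ideal (nonface_ideal (minor face T D)) 'X_x f.
Proof.
move=> dc.
have iJ D' : is_ideal (nonface_ideal (K := K) (minor face T D')).
  exact/nonface_ideal_is_ideal/minor_down_closed.
split.
  move: f; apply: monomial_ideal_sub; first exact: add_ideal_is_ideal.
  move=> u; rewrite /minor disjoint_sym disjoint_setU1 disjoint_sym.
  case: (boolP (x \in supp u)) => /= [|_ hu]; last first.
    by apply/add_idealS/monomial_idealX; apply: hu.
  rewrite inE lt0n => xu _; exists 'X_[u - U_(x)].
  rewrite -mpolyXD submK ?subrr.
    exact: (ideal0 (iJ D)).
  by rewrite lep1mP.
apply: add_ideal_min => // [g hg u /hg|].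
  apply: contra; rewrite /minor disjoint_sym disjoint_setU1 disjoint_sym -andbA.
  by case/andP.
apply/monomial_idealX; rewrite suppU /minor disjoint_sym disjoint_setU1.
by rewrite inE eqxx.
Qed.

(** The full simplex on the complement of D, whose Stanley-Reisner ideal is the
    prime ideal generated by the variables in D. *)
Definition avoid D F := [disjoint F & D].

Definition elementary_seq r : seq S := [seq mesym n K i.+1 | i <- iota 0 r].

Definition graded J := forall d f, J f -> J (pihomog mdeg d f).

Lemma pihomogM_homog e d k f : e \is k.-homog ->
  exists c : S, pihomog mdeg d (f * e) = c * e.
Proof.
move=> he; elim/mpolyind: f => [|c m p _ _ [c1 hc1]].
  by exists 0; rewrite !mul0r pihomog0.
rewrite mulrDl pihomogD hc1.
suff [c2 ->] : exists c2, pihomog mdeg d (c *: 'X_[m] * e) = c2 * e.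
  by exists (c2 + c1); rewrite mulrDl.
have hm : c *: 'X_[m] * e \is (mdeg m + k).-homog.
  by apply: dhomogM => //; apply: dhomogZ; rewrite dhomogX.
have [->|ne] := eqVneq d (mdeg m + k)%N.
  by exists (c *: 'X_[m]); rewrite pihomog_dE.
by exists 0; rewrite mul0r (pihomog_ne0 _ hm) // eq_sym.
Qed.

Lemma add_ideal_graded J e k :
  graded J -> e \is k.-homog -> graded (add_ideal J e).
Proof.
move=> gJ he d f [c hc]; have [c' hc'] := pihomogM_homog d c he.
by exists c'; rewrite -hc' -pihomogB; apply: gJ.
Qed.

Lemma nonface_graded face : graded (nonface_ideal (K := K) face).
Proof.
move=> d f hf u; rewrite pihomogE => /msupp_sum_le/flattenP[s /mapP[v]].
rewrite mem_filter => /andP[_ vf] -> /msuppZ_le; rewrite msuppX inE => /eqP->.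
exact: hf.
Qed.

(** Krull intersection for a graded ideal: the component of degree d is not
    affected by multiples of the (d+1)st power of a variable. *)
Lemma graded_separated J x f : is_ideal J -> graded J ->
  (forall t, exists c, J (f - c * 'X_x ^+ t)) -> J f.
Proof.
move=> iJ gJ hf; rewrite (pihomog_partitionE (leqnn (msize f))).
apply: ideal_sum => // d _; have [c hc] := hf d.+1.
suff <- : pihomog mdeg d (f - c * 'X_x ^+ d.+1) = pihomog mdeg d f by apply: gJ.
rewrite pihomogB; apply/eqP; rewrite subr_eq addrC -subr_eq subrr eq_sym.
rewrite pihomogE big1_seq // => u /andP[/eqP du].
move/msuppM_le/allpairsP=> [[u1 u2] /= [_ hu2 eu]].
move: hu2; rewrite mpolyXn msuppX inE => /eqP eu2.
have {du} : mdeg u = d by []; rewrite eu eu2 mdegD mdegMn mdeg1 mul1n; lia.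
Qed.

(** Moving a variable from the front of a regular sequence to its end.  Each
    homogeneous f stays a nonzerodivisor before x is divided out: an element
    killed by f is a multiple of x, the quotient is killed by f again, and so on,
    so the element is divisible by all powers of x. *)
Lemma graded_regular_swap J x s : is_ideal J -> graded J ->
    (forall f, f \in s -> exists k, f \is k.-homog) ->
    (forall h, J ('X_x * h) -> J h) -> wregular (add_ideal J 'X_x) s ->
  wregular J s /\ forall h, add_seq J s ('X_x * h) -> add_seq J s h.
Proof.
elim: s J => [|e s IH] J iJ gJ hs rx //= [re rs].
have [k he] := hs e (mem_head _ _).
have rJe h : J (e * h) -> J h.
  move=> hh; apply: (graded_separated (x := x)) => // t.
  elim: t => [|t [c hc]].
    by exists h; rewrite expr0 mulr1 subrr; apply: ideal0.
  have hc' : J (e * c).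
    suff : J ('X_x ^+ t * (e * c)).
      elim: (t) => [|t' IHt]; first by rewrite expr0 mul1r.
      by rewrite exprS -mulrA => /rx.
    have -> : 'X_x ^+ t * (e * c) = e * h - e * (h - c * 'X_x ^+ t) by ring.
    by apply: idealB => //; apply: idealMl.
  have [d hd] : add_ideal J 'X_x c by apply/re/add_idealS.
  exists d; rewrite exprS.
  have -> : h - d * ('X_x * 'X_x ^+ t) =
      (h - c * 'X_x ^+ t) + 'X_x ^+ t * (c - d * 'X_x) by ring.
  by apply: idealD => //; apply: idealMl.
suff [h1 h2] : wregular (add_ideal J e) s /\
    forall h, add_seq (add_ideal J e) s ('X_x * h) ->
      add_seq (add_ideal J e) s h.
  by [].
apply: IH.
- exact: add_ideal_is_ideal.
- exact: add_ideal_graded he.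
- by move=> f fs; apply: hs; rewrite inE fs orbT.
- move=> h [g hg].
  have [c hc] : add_ideal J 'X_x g.
    apply: re; exists h.
    have -> : e * g - h * 'X_x = - 1 * ('X_x * h - g * e) by ring.
    exact: idealMl.
  exists c; apply: rx.
  have -> : 'X_x * (h - c * e) =
      ('X_x * h - g * e) + e * (g - c * 'X_x) by ring.
  by apply: idealD => //; apply: idealMl.
- apply: wregular_ext rs => h; split=> -[c [d hd]]; exists d; exists c;
    by rewrite addrAC.
Qed.

Lemma avoid_down_closed D : down_closed (avoid D).
Proof. by move=> A B sAB; apply: disjointWl. Qed.

Lemma avoid_is_ideal D : is_ideal (nonface_ideal (K := K) (avoid D)).
Proof. exact/nonface_ideal_is_ideal/avoid_down_closed. Qed.

Lemma avoid_add D x f : nonface_ideal (K := K) (avoid (x |: D)) f <->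
  add_ideal (nonface_ideal (avoid D)) 'X_x f.
Proof.
have := @nonface_add xpredT set0 D x f (fun _ _ _ _ => isT).
have e D' g : nonface_ideal (K := K) (minor xpredT set0 D') g <->
    nonface_ideal (avoid D') g.
  by split=> h u /h; rewrite /minor andbT.
rewrite e => ->; split=> -[c hc]; exists c; exact/e.
Qed.

Lemma avoid_regular D x f : x \notin D ->
  nonface_ideal (K := K) (avoid D) ('X_x * f) -> nonface_ideal (avoid D) f.
Proof.
move=> xD /monomial_idealXM h u /h.
by rewrite /avoid suppD suppU disjoint_setU1 xD.
Qed.

Lemma elementary_homog r f : f \in elementary_seq r -> exists k, f \is k.-homog.
Proof. by case/mapP=> i _ ->; exists i.+1; apply: dhomog_mesym. Qed.

(** With exactly s variables left, e_s becomes their product. *)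
Lemma mesym_avoid D : nonface_ideal (avoid D)
  (mesym n K #|~: D| - 'X_[mesym1 (~: D)]).
Proof.
rewrite mesymE (bigD1 (~: D)) //= addrAC subrr add0r.
apply: ideal_sum; first exact: avoid_is_ideal.
move=> A /andP[/eqP cA neA]; apply/monomial_idealX; rewrite supp_mesym1.
rewrite /avoid; apply: contra neA; rewrite disjoints_subset => h.
by rewrite eqEcard h cA leqnn.
Qed.

(** Induction on the number of variables outside D.  Dividing out one of them, y,
    leaves a smaller case in which e_1, ..., e_c are regular; by
    graded_regular_swap they are then regular before y is divided out, and y is
    a nonzerodivisor after them.  This holds for each y, hence for the product
    of all y, which is e_(c+1). *)
Lemma elementary_regular D r : (r <= #|~: D|)%N ->
  wregular (nonface_ideal (avoid D)) (elementary_seq r).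
Proof.
move: {2}#|~: D| (erefl #|~: D|) => c; elim: c D r => [|c IH] D r cD.
  by rewrite cD leqn0 => /eqP->.
move=> le_r; have ex y : y \notin D -> #|~: (y |: D)| = c.
  by move=> yD; apply/eqP; rewrite -eqSS -cD (card_setC_setU1 yD).
have swap y : y \notin D ->
    wregular (nonface_ideal (avoid D)) (elementary_seq c) /\
    forall h, add_seq (nonface_ideal (avoid D)) (elementary_seq c) ('X_y * h) ->
    add_seq (nonface_ideal (avoid D)) (elementary_seq c) h.
  move=> yD; apply: graded_regular_swap.
  - exact: avoid_is_ideal.
  - exact: nonface_graded.
  - exact: elementary_homog.
  - by move=> h; apply: avoid_regular.
  - apply: wregular_ext (IH _ c (ex y yD) _); last by rewrite ex.
    by move=> h; apply: avoid_add.
suff : wregular (nonface_ideal (avoid D)) (elementary_seq c.+1).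
  rewrite /elementary_seq -cD -(subnKC le_r) iotaD map_cat.
  by case/wregular_cat.
rewrite /elementary_seq -addn1 iotaD map_cat /= add0n.
have [y yD] : exists y, y \in ~: D by apply/set0Pn; rewrite -card_gt0 cD.
apply/wregular_cat; split.
  by apply: (swap y _).1; rewrite -in_setC.
split=> // h; rewrite -cD => hh.
set J := add_seq _ _ in hh *.
have iJ : is_ideal J by apply/add_seq_is_ideal/avoid_is_ideal.
have {hh} : J ('X_[mesym1 (~: D)] * h).
  have -> : 'X_[mesym1 (~: D)] * h =
      mesym n K #|~: D| * h
        - h * (mesym n K #|~: D| - 'X_[mesym1 (~: D)]) by ring.
  by apply: idealB => //; apply: idealMl => //; apply/add_seqS/mesym_avoid.
have -> : 'X_[K, mesym1 (~: D)] = \prod_(i <- enum (~: D)) 'X_i.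
  rewrite big_enum /= mprodXE; congr 'X_[_]; apply/mnmP=> i.
  rewrite mnmE mnm_sumE; case: (boolP (i \in ~: D)) => iD.
    rewrite (bigD1 i) //= mnm1E eqxx big1 // => j /andP[_ /negPf ji].
    by rewrite mnm1E ji.
  rewrite big1 // => j jD; rewrite mnm1E; case: eqP => // ji.
  by rewrite -ji jD in iD.
have : all (mem (~: D)) (enum (~: D)) by apply/allP=> z; rewrite mem_enum.
elim: (enum _) => [|z zs IHz] /=; first by rewrite big_nil mul1r.
case/andP=> zD hzs; rewrite big_cons -mulrA => hh; apply: IHz => //.
by apply: (swap z _).2 hh; rewrite -in_setC.
Qed.

Lemma minor_split face r T D x : down_closed face -> x \notin D ->
    wregular (nonface_ideal (minor face (x |: T) D)) (elementary_seq r) ->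
    wregular (nonface_ideal (minor face T (x |: D))) (elementary_seq r) ->
  wregular (nonface_ideal (minor face T D)) (elementary_seq r).
Proof.
move=> dc xD; apply: (wregular_extension (x := 'X_x)).
- exact/nonface_ideal_is_ideal/minor_down_closed.
- exact/nonface_ideal_is_ideal/minor_down_closed.
- exact/nonface_ideal_is_ideal/minor_down_closed.
- by move=> h; apply: nonface_colon.
- by move=> h; apply: nonface_add.
Qed.

Lemma wregular_trivial J s : (forall f, J f) -> wregular J s.
Proof.
elim: s J => //= f s IH J hJ; split=> [h _|]; first exact: hJ.
by apply: IH => h; exists 0; apply: hJ.
Qed.

Lemma minor_void face r T D : down_closed face -> ~~ face T ->
  wregular (nonface_ideal (minor face T D)) (elementary_seq r).
Proof.
move=> dc nT; apply: wregular_trivial => f u _; apply: contra nT.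
by case/andP=> _; apply: dc; apply: subsetUr.
Qed.

Lemma minor_simplex face r T D : down_closed face ->
    [disjoint T & D] -> face (~: D) -> (r <= #|~: D|)%N ->
  wregular (nonface_ideal (minor face T D)) (elementary_seq r).
Proof.
move=> dc dTD hD /elementary_regular; apply: wregular_ext.
have e F : minor face T D F = avoid D F.
  rewrite /minor /avoid; case: (boolP [disjoint F & D]) => //= hF; apply: dc hD.
  by rewrite subUset -!disjoints_subset hF.
by move=> h; split=> hh u /hh; rewrite e.
Qed.

End LowerBound.

(** * A facet bounds the length of a regular sequence *)

Section UpperBound.
Variables (K : fieldType) (n : nat).
Local Notation S := {mpoly K[n]}.
Implicit Types (J C : S -> Prop) (u v w : 'X_{1..n}) (A D F T : {set 'I_n}).
Implicit Types (face : {set 'I_n} -> bool) (s : seq S).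

(** The monomials in s with all exponents below b are numbered by the integers
    below b^(size s): the base b digits of j are the exponents. *)
Fixpoint digit_monomial (b : nat) s (j : nat) : S :=
  if s is f :: s' then f ^+ (j %% b) * digit_monomial b s' (j %/ b) else 1.

Lemma big_digits (b c : nat) (V : nmodType) (E : nat -> V) :
  \sum_(j < c * b) E j = \sum_(i < b) \sum_(j < c) E (j * b + i)%N.
Proof.
rewrite exchange_big /=; elim: c => [|c IH]; first by rewrite !big_ord0.
rewrite mulSnr big_split_ord /= IH big_ord_recr /=.
by congr (_ + _).
Qed.

(** Scalars form a field, so the first nonzero coefficient of a relation is a
    unit.  Order the exponents lexicographically, with f first: dividing the
    relation by the least power of f that occurs and reducing modulo f leaves a
    nontrivial relation in the remaining elements. *)
Lemma constant_relation_regular J s b (g : nat -> K) (p : S) :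
    is_ideal J -> wregular J s -> (exists2 j, (j < b ^ size s)%N & g j != 0) ->
    J (\sum_(j < b ^ size s) g j *: digit_monomial b s j * p) ->
  add_seq J s p.
Proof.
elim: s J g => [|f s IH] J g iJ /=.
  move=> _ [j]; rewrite expn0 ltnS leqn0 => /eqP-> g0; rewrite big_ord1 => hp.
  have := idealMl (g 0%N)^-1%:MP iJ hp.
  by rewrite mul_mpolyC scalerAl scalerA mulVf // scale1r mul1r.
case=> rf rs [j0 hj0 gj0]; have b0 : (0 < b)%N.
  by rewrite lt0n; apply: contraTneq hj0 => ->; rewrite exp0n.
pose c := (b ^ size s)%N.
pose E i := \sum_(j < c) g (j * b + i)%N *: digit_monomial b s j * p.
pose G j := g j *: (f ^+ (j %% b) * digit_monomial b s (j %/ b)) * p.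
rewrite expnSr -/c (big_digits b c G) => hJ.
have {hJ} : J (\sum_(i < b) f ^+ i * E i).
  have -> // : \sum_(i < b) f ^+ i * E i =
      \sum_(i < b) \sum_(j < c) G (j * b + i)%N.
  apply: eq_bigr => i _; rewrite mulr_sumr; apply: eq_bigr => j _.
  rewrite /G modnMDl modn_small // divnMDl // divn_small // addn0.
  by rewrite -!scalerAl -scalerAr mulrA.
(* The least exponent i0 of f that occurs with a nonzero coefficient. *)
pose P i := [exists j : 'I_c, g (j * b + i)%N != 0].
have exP : exists i, P i.
  exists (j0 %% b)%N; apply/existsP.
  have lt : (j0 %/ b < c)%N by rewrite ltn_divLR // -expnSr.
  by exists (Ordinal lt); rewrite /= -divn_eq.
case: (ex_minnP exP) => i0 /existsP[j1 gj1] min_i0.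
have lt_i0 : (i0 < b)%N.
  apply: leq_ltn_trans (ltn_pmod j0 b0); apply: min_i0; apply/existsP.
  have lt : (j0 %/ b < c)%N by rewrite ltn_divLR // -expnSr.
  by exists (Ordinal lt); rewrite /= -divn_eq.
have E0 i : (i < i0)%N -> E i = 0.
  move=> lt_i; rewrite /E big1 // => j _; suff /eqP-> : g (j * b + i)%N == 0.
    by rewrite scale0r mul0r.
  apply: contraLR lt_i => gj; rewrite -leqNgt; apply: min_i0.
  by apply/existsP; exists j.
pose R := \sum_(i < b | (i0 < i)%N) f ^+ (i - i0.+1) * E i.
have -> : \sum_(i < b) f ^+ i * E i = f ^+ i0 * (E i0 + f * R).
  rewrite (bigD1 (Ordinal lt_i0)) //= mulrDr; congr (_ + _).
  rewrite (bigID (fun i : 'I_b => (i < i0)%N)) /= big1 ?add0r; last first.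
    by move=> i /andP[_ /E0->]; rewrite mulr0.
  rewrite mulrA -exprSr /R mulr_sumr.
  apply: eq_big => [i|i /andP[ne le_i]].
    by rewrite -leqNgt ltn_neqAle -val_eqE /= eq_sym.
  rewrite mulrA -exprD subnKC // ltn_neqAle leqNgt le_i andbT.
  by rewrite -val_eqE eq_sym in ne.
move=> hJ; apply: (IH (add_ideal J f) (fun j => g (j * b + i0)%N)) => //.
- exact: add_ideal_is_ideal.
- by exists j1.
- exists (- R); suff : J (E i0 + f * R) by rewrite mulNr opprK mulrC.
  elim: (i0) (E i0 + f * R) hJ => [|k IHk] x; first by rewrite expr0 mul1r.
  by rewrite exprS -mulrA => /rf/IHk.
Qed.

Lemma digit_monomial_deg b s d j u : (0 < b)%N ->
    (forall f, f \in s -> forall v, v \in msupp f -> (mdeg v <= d)%N) ->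
  u \in msupp (digit_monomial b s j) -> (mdeg u <= size s * (d * b))%N.
Proof.
move=> b0; elim: s j u => [|f s IH] j u hs /=.
  by rewrite msupp1 inE => /eqP->; rewrite mdeg0.
have hpow k v : v \in msupp (f ^+ k) -> (mdeg v <= d * k)%N.
  elim: k v => [|k IHk] v.
    by rewrite expr0 msupp1 inE => /eqP->; rewrite mdeg0.
  rewrite exprS => /msuppM_le/allpairsP[[v1 v2] /= [h1 h2 ->]].
  by rewrite mdegD mulnS leq_add ?IHk //; apply: hs h1; apply: mem_head.
move/msuppM_le/allpairsP=> [[v1 v2] /= [h1 h2 ->]].
rewrite mdegD mulSn leq_add //.
  by apply: leq_trans (hpow _ _ h1) _; rewrite leq_mul2l ltnW ?orbT // ltn_pmod.
by apply: IH h2 => g gs; apply: hs; rewrite inE gs orbT.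
Qed.

(** Counting: modulo the variables outside F, the b^t monomials in s have degree
    at most t d b in |F| variables, hence lie in a space of dimension at most
    (t d b + 1)^|F|, which is smaller than b^t for large b, since |F| < t. *)
Lemma algebraic_dependence s F : (#|F| < size s)%N ->
  exists b (g : nat -> K), (exists2 j, (j < b ^ size s)%N & g j != 0) /\
    nonface_ideal (avoid (~: F))
      (\sum_(j < b ^ size s) g j *: digit_monomial b s j).
Proof.
move=> lt_F; set t := size s in lt_F *.
pose d := \max_(f <- s) msize f.
have hd f : f \in s -> forall v, v \in msupp f -> (mdeg v <= d)%N.
  move=> fs v /msize_mdeg_lt/ltnW h; apply: leq_trans h _.
  by rewrite /d (big_rem f fs) leq_maxl.
(* This b exceeds (t d + 1)^|F|, so b^t > ((t d + 1) b)^|F|. *)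
pose b := ((t * d).+1 ^ #|F|).+1; pose L := (t * (d * b))%N.
(* Exponent vectors of degree at most L supported in F. *)
pose Mset := [set phi : {ffun 'I_n -> 'I_L.+1} |
  phi \in pffun_on ord0 (mem F) predT].
have cardM : (#|Mset| < b ^ t)%N.
  have -> : #|Mset| = (L.+1 ^ #|F|)%N.
    by rewrite cardsE card_pffun_on card_ord.
  have le1 : (L.+1 <= (t * d).+1 * b)%N by rewrite /L /b; nia.
  apply: leq_ltn_trans (_ : ((t * d).+1 * b) ^ #|F| < _)%N.
    by case: #|F| => // k; rewrite leq_exp2r.
  rewrite expnMn; apply: leq_trans (_ : b ^ #|F|.+1 <= _)%N.
    by rewrite expnS ltn_mul2r expn_gt0 /= ltnS leqnn.
  by rewrite leq_pexp2l.
pose mu (phi : {ffun 'I_n -> 'I_L.+1}) := [multinom (phi i : nat) | i < n].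
pose M := \matrix_(j < b ^ t, k < #|Mset|)
  (digit_monomial b s j)@_(mu (enum_val k)).
have : kermx M != 0.
  rewrite kermx_eq0 -row_leq_rank -ltnNge.
  exact: leq_ltn_trans (rank_leq_col _) cardM.
case/rowV0Pn => v /sub_kermxP vM v0.
have [j0 vj0] : exists j, v 0 j != 0.
  apply/existsP; apply: contraR v0 => /existsPn h; apply/eqP/rowP=> j.
  by rewrite mxE; apply/eqP; have := h j; rewrite negbK.
pose g (j : nat) := if insub j is Some k then v 0 k else 0.
have gE (j : 'I_(b ^ t)) : g j = v 0 j by rewrite /g valK.
exists b, g; split; first by exists j0; rewrite ?gE.
move=> u hu; apply/negP.
rewrite /avoid disjoint_sym -setI_eq0 setIC -setDE setD_eq0 => suF.
have deg_u : (mdeg u <= L)%N.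
  case/msupp_sum_le/flattenP: (hu) => l /mapP[j _ ->] /msuppZ_le.
  exact: digit_monomial_deg.
have lt_u i : (u i < L.+1)%N.
  by rewrite ltnS (leq_trans _ deg_u) // mdegE (bigD1 i) //= leq_addr.
pose phi := [ffun i => Ordinal (lt_u i)].
have phiM : phi \in Mset.
  rewrite inE; apply/pffun_onP; split=> //.
  apply/subsetP=> i; rewrite inE ffunE -val_eqE /= => ui.
  by apply: (subsetP suF); rewrite inE lt0n.
have muphi : mu phi = u by apply/mnmP=> i; rewrite mnmE ffunE.
move: hu; rewrite mcoeff_msupp => /negP; apply; apply/eqP.
rewrite raddf_sum /=.
have hM (j : 'I_(b ^ t)) : (g j *: digit_monomial b s j)@_u =
    v 0 j * M j (enum_rank_in phiM phi).
  by rewrite mcoeffZ gE mxE enum_rankK_in // muphi.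
have /rowP/(_ (enum_rank_in phiM phi)) := vM; rewrite !mxE => h0.
rewrite -[RHS]h0.
by apply: eq_bigr => j _; apply: hM.
Qed.

(** The monomial x_F spans a copy of the polynomial ring in the variables of F
    inside S/J.  The powers with exponent |F| + 1 of a longer regular sequence
    satisfy a constant relation on it, so x_F lies in J plus the ideal of these
    powers; but x_F is not in J and its degree is too small. *)
Lemma depth_le_facet face F s : down_closed face ->
    face F -> (forall x, x \notin F -> ~~ face (x |: F)) ->
    (forall f, f \in s -> monomial_ideal (fun u => 0 < mdeg u)%N f) ->
  wregular (nonface_ideal face) s -> (size s <= #|F|)%N.
Proof.
move=> dc hF maxF hs rs; rewrite leqNgt; apply/negP=> lt_F.
have iJ : is_ideal (nonface_ideal (K := K) face).
  exact: nonface_ideal_is_ideal.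
(* The exponent |F| + 1 makes every monomial of the powers have degree > |F|. *)
have rsN := wregular_map_exp #|F| iJ rs.
set sN := map _ _ in rsN; have size_sN : size sN = size s by rewrite size_map.
case: (@algebraic_dependence sN F); first by rewrite size_sN.
move=> b [g [hg dep]].
have : add_seq (nonface_ideal face) sN 'X_[mesym1 F].
  apply: constant_relation_regular hg _ => //; rewrite -mulr_suml mulrC.
  apply/monomial_idealXM => u /dep.
  rewrite /avoid disjoints_subset setCK => /subsetPn[x xu xF].
  apply: contra (maxF x xF); apply: dc.
  by rewrite suppD supp_mesym1 subUset sub1set inE xu orbT /= subsetUl.
pose Q u := ~~ face (supp u) \/ (#|F| < mdeg u)%N.
have iQ : is_ideal (monomial_ideal (K := K) Q).
  apply: monomial_ideal_is_ideal => u v [h|h]; [left|right].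
    by apply: contra h; apply: dc; rewrite suppD subsetUl.
  by rewrite mdegD ltn_addr.
move/(add_seq_min (C := monomial_ideal Q) iQ).
case/(_ _ _)/monomial_idealX.
- by move=> x hx u /hx; left.
- move=> _ /mapP[f fs ->] u hu; right.
  elim: (#|F|) u hu => [|k IH] u; first by rewrite expr1 => /hs; apply.
  rewrite exprS => /msuppM_le/allpairsP[[v1 v2] /= [/(hs f fs) h1 /IH h2 ->]].
  by rewrite mdegD; lia.
- by rewrite supp_mesym1 hF.
- by rewrite mdeg_mesym1 ltnn.
Qed.

Lemma max_ideal_monomials (f : S) :
  max_ideal f <-> monomial_ideal (fun u => 0 < mdeg u)%N f.
Proof.
split.
  apply: ideal_gen_min.
    by apply: monomial_ideal_is_ideal => u v h; rewrite mdegD ltn_addr.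
  by move=> g [i ->]; apply/monomial_idealX; rewrite mdeg1.
move: f; apply: monomial_ideal_sub; first exact: ideal_gen_is_ideal.
move=> u; rewrite lt0n mdeg_eq0 => u0.
have [i ui] : exists i, u i != 0%N.
  apply/existsP; apply: contraR u0 => /existsPn h; apply/eqP/mnmP=> i.
  by rewrite mnm0E; apply/eqP; have := h i; rewrite negbK.
rewrite -(submK (m := U_(i)) (m' := u)) ?lep1mP // mpolyXD.
apply: idealMl; first exact: ideal_gen_is_ideal.
by apply: ideal_gen_sub; exists i.
Qed.

End UpperBound.

(** * Regular sequences of monomials *)

Section MonomialSequences.
Variables (K : fieldType) (n : nat).
Local Notation S := {mpoly K[n]}.
Implicit Types (us : seq 'X_{1..n}) (u v w : 'X_{1..n}).

Lemma zero_ideal : is_ideal (fun f : S => f = 0).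
Proof.
by split=> [//|x y -> ->|c x ->]; rewrite ?addr0 ?mulr0.
Qed.

Lemma add_seq_monomials us (f : S) :
  add_seq (fun f : S => f = 0) [seq 'X_[u] | u <- us] f <->
  monomial_ideal (fun w => exists2 v, v \in us & (v <= w)%MM) f.
Proof.
have iA := add_seq_is_ideal [seq 'X_[u] | u <- us] zero_ideal.
split.
  apply: add_seq_min.
  - apply: monomial_ideal_is_ideal => u w [v vus le_vu]; exists v => //.
    exact/(lepm_trans le_vu)/lem_addr.
  - by move=> _ -> u; rewrite msupp0.
  - move=> _ /mapP[u uus ->]; apply/monomial_idealX; exists u => //.
    exact: lepm_refl.
move: f; apply: monomial_ideal_sub => // w [v vus le_vw].
rewrite -(submK le_vw) mpolyXD; apply: idealMl => //.
by apply: add_seq_mem; [exact: zero_ideal | apply: map_f].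
Qed.

Definition coprime_supp u v := [disjoint supp u & supp v].

Lemma coprime_supp_sym u v : coprime_supp u v = coprime_supp v u.
Proof. by rewrite /coprime_supp disjoint_sym. Qed.

Lemma pairwise_coprime_mem us u v : pairwise coprime_supp us ->
  u \in us -> v \in us -> u != v -> coprime_supp u v.
Proof.
pose r u v := (u == v) || coprime_supp u v.
have rr : reflexive r by move=> w; rewrite /r eqxx.
have rs : ssrbool.symmetric r.
  by move=> w1 w2; rewrite /r eq_sym coprime_supp_sym.
move/(sub_pairwise (r' := r)) => h uus vus /negPf ne.
have : pairwise r us by apply: h => w1 w2 h; rewrite /r h orbT.
by rewrite pairwise_all2rel // => /allrelP/(_ u v uus vus); rewrite /r ne.
Qed.

(** If x divides both v, in us, and the next element u, then u (v / x) is a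
    multiple of v, so regularity puts v / x into the ideal of us; some w in us
    then divides v / x.  It differs from v, so it is coprime to v and must
    be 1. *)
Lemma regular_monomials us :
  wregular (fun f : S => f = 0) [seq 'X_[u] | u <- us] /\
    ~ add_seq (fun f : S => f = 0) [seq 'X_[u] | u <- us] 1 <->
  pairwise coprime_supp us /\ 0%MM \notin us.
Proof.
elim/last_ind: us => [|us u IH].
  split=> // _; split=> //=; apply/eqP; exact: oner_neq0.
rewrite map_rcons -cats1 wregular_cat pairwise_rcons mem_rcons inE negb_or.
set s := map _ _ in IH *; set J := add_seq _ s in IH *.
have iJ : is_ideal J by apply/add_seq_is_ideal/zero_ideal.
have catE f : add_seq (fun f : S => f = 0) (s ++ [:: 'X_[u]]) f <->
    monomial_ideal (fun w => exists2 v, v \in rcons us u & (v <= w)%MM) f.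
  by rewrite -add_seq_monomials map_rcons -cats1.
split=> [[[rs [ru _]]]|[/andP[/allP cu pw] /andP[u0 us0]]].
  move=> n1; have [pw us0] : pairwise coprime_supp us /\ 0%MM \notin us.
    apply/IH; split=> // /add_seq_monomials h1; apply/n1/catE.
    move=> w /h1[v vus le_vw].
    by exists v => //; rewrite mem_rcons inE vus orbT.
  split; last first.
    rewrite us0 andbT; apply/eqP=> eu; apply/n1/catE => w _; exists u.
      by rewrite mem_rcons mem_head.
    by rewrite -eu; apply/mnm_lepP=> i; rewrite mnm0E.
  rewrite pw andbT; apply/allP=> v vus; rewrite /coprime_supp -setI_eq0.
  apply/set0Pn=> -[x]; rewrite !inE => /andP[xv xu].
  have lev : (U_(x) <= v)%MM by rewrite lep1mP -lt0n.
  have leu : (U_(x) <= u)%MM by rewrite lep1mP -lt0n.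
  have /ru : J ('X_[u] * 'X_[v - U_(x)]).
    apply/add_seq_monomials; rewrite -mpolyXD; apply/monomial_idealX.
    exists v => //; apply/mnm_lepP=> i; rewrite mnmDE mnmBE.
    by move/mnm_lepP/(_ i): leu; lia.
  move/add_seq_monomials/monomial_idealX => [w wus le_w].
  have le_wv : (w <= v)%MM by apply: lepm_trans le_w (lem_subr _ _).
  have ne : w != v.
    apply/eqP=> ewv; move/mnm_lepP/(_ x): le_w.
    by rewrite ewv mnmBE mnm1E eqxx; lia.
  have := pairwise_coprime_mem pw wus vus ne; rewrite /coprime_supp => dwv.
  have w0 : supp w = set0.
    by apply/eqP; rewrite -(setIidPl (suppS le_wv)) setI_eq0.
  move: us0; suff <- : w = 0%MM by rewrite wus.
  apply/mnmP=> i; rewrite mnm0E; have /setP/(_ i) := w0.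
  by rewrite !inE; case: (w i).
case: IH => _ [//|rs n1]; split.
  split=> //; split=> // h /add_seq_monomials/monomial_idealXM hh.
  apply/add_seq_monomials => w /hh[v vus le_v]; exists v => //.
  apply/mnm_lepP=> i; move/mnm_lepP/(_ i): le_v; rewrite mnmDE.
  have := cu v vus; rewrite /coprime_supp => dvu.
  have := @disjointFr _ _ _ i dvu; rewrite !inE.
  by case: (v i) => // vi /(_ isT); case: (u i).
move/catE/(_ 0%MM); rewrite msupp1 mem_head => /(_ isT)[v vus /mnm_lepP le_v0].
have v0 : v = 0%MM.
  by apply/mnmP=> i; have := le_v0 i; rewrite mnm0E leqn0 => /eqP.
by move: vus; rewrite v0 mem_rcons inE (negPf us0) orbF (negPf u0).
Qed.

End MonomialSequences.

(** * Deciding vertices by link and deletion *)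

Section DecisionTree.
Variables (K : fieldType) (n m r : nat) (face : {set 'I_n} -> bool).
Variable W : 'I_m -> {set 'I_n}.
Hypothesis dc : down_closed face.
Implicit Types (A B D F T : {set 'I_n}).

Definition good T D :=
  wregular (nonface_ideal (K := K) (minor face T D)) (elementary_seq K n r).

(** The condition under which the remaining vertices may be decided in any
    order.  If T is not a face the quotient is zero; otherwise one more vertex may
    be deleted as long as more than r are undeleted, and once r of them remain
    they form a face. *)
Definition settled T D :=
  ~~ face T \/ forall F, F \subset ~: D -> (#|F| <= r)%N -> face F.

Lemma good_settled T D : [disjoint T & D] -> (r <= #|~: D|)%N ->
  settled T D -> good T D.
Proof.
move: {2}_.+1 (ltnSn #|~: (T :|: D)|) => c.
elim: c T D => // c IH T D lt_c dTD le_r sTD.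
have [fT|nfT] := boolP (face T); last exact: minor_void.
have [fD|nfD] := boolP (face (~: D)); first exact: minor_simplex.
case: sTD => [|sTD]; first by rewrite fT.
have lt_r : (r < #|~: D|)%N.
  by rewrite ltnNge; apply: contra nfD; apply: sTD.
have /subsetPn[x xD xT] : ~~ (~: D \subset T).
  by apply: contra nfD => h; apply: dc fT.
have xTD : x \notin T :|: D by rewrite inE negb_or xT -in_setC.
have cx : (#|~: (x |: (T :|: D))| < c)%N.
  by rewrite -ltnS (leq_trans _ lt_c) // ltnS -card_setC_setU1.
rewrite inE in xD; apply: (minor_split (x := x)) => //.
  apply: IH => //; [by rewrite -setUA | by rewrite disjoint_setU1 xD | by right].
apply: IH; first by rewrite setUCA.
- by rewrite disjoint_sym disjoint_setU1 xT disjoint_sym.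
- by rewrite -ltnS -card_setC_setU1.
- right=> F sF; apply: sTD; apply: subset_trans sF _.
  by rewrite setCS subsetUr.
Qed.

(** A block inside T is certain to be contained in all the faces under
    consideration, and a block meeting D in none of them. *)
Definition undecided T D :=
  [set i | ~~ (W i \subset T) && [disjoint W i & D]].

(** Pick a vertex of an undecided block: deleting it decides the block, so each
    deletion is paid for by one undecided block, and the number of undeleted
    vertices never falls below r. *)
Lemma good_undecided T D :
    (forall T D, [disjoint T & D] -> undecided T D = set0 -> settled T D) ->
    [disjoint T & D] -> (#|undecided T D| + r <= #|~: D|)%N ->
  good T D.
Proof.
move=> hs; move: {2}_.+1 (ltnSn #|~: (T :|: D)|) => c.
elim: c T D => // c IH T D lt_c dTD le_r.
have [u0|[i]] := set_0Vmem (undecided T D).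
  by apply: good_settled; [| apply: leq_trans le_r; apply: leq_addl | apply: hs].
rewrite inE => /andP[/subsetPn[x xW xT] dW].
have xD : x \notin D by apply/negP=> xD; rewrite (disjointFr dW xW) in xD.
have xTD : x \notin T :|: D by rewrite inE negb_or xT.
have cx : (#|~: (x |: (T :|: D))| < c)%N.
  by rewrite -ltnS (leq_trans _ lt_c) // ltnS -card_setC_setU1.
apply: (minor_split (x := x)) => //.
  apply: IH; [by rewrite -setUA | by rewrite disjoint_setU1 xD |].
  apply: leq_trans le_r; rewrite leq_add2r; apply/subset_leq_card/subsetP=> j.
  rewrite !inE => /andP[h ->]; rewrite andbT; apply: contra h => h.
  by apply: subset_trans h _; apply: subsetUr.
apply: IH; first by rewrite setUCA.
  by rewrite disjoint_sym disjoint_setU1 xT disjoint_sym.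
rewrite -ltnS -card_setC_setU1 //; apply: leq_trans le_r.
rewrite -addSn leq_add2r; apply/proper_card/properP; split.
  apply/subsetP=> j; rewrite !inE => /andP[-> h] /=.
  by apply: disjointWr h; apply: subsetUr.
exists i; rewrite !inE; first by rewrite dW andbT; apply/subsetPn; exists x.
by rewrite disjoint_sym disjoint_setU1 xW andbF.
Qed.

End DecisionTree.

(** * Disjoint generators of the ideal *)

Section Blocks.
Variables (K : fieldType) (n m b : nat) (q : nat -> nat).
Variable W : 'I_m -> {set 'I_n}.
Hypothesis b_gt0 : (0 < b)%N.
Hypothesis q_le : forall i, (q i <= b)%N.
Hypothesis q_mono : forall i j, (i <= j)%N -> (j < m)%N -> (q i <= q j)%N.
Hypothesis q_gt : forall i, (i < m)%N -> (m < q i)%N.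
Hypothesis cardW : forall i : 'I_m, #|W i| = q i.
Hypothesis disjW : forall i j, i != j -> [disjoint W i & W j].
Hypothesis n_def : n = (\sum_(i < m) q i + b.-1)%N.
Implicit Types (A B D F G T : {set 'I_n}) (u v : 'X_{1..n}).

Definition gen A := (#|A| == b) || [exists i, A == W i].

Fixpoint matchable k F :=
  if k is k'.+1 then
    [exists G, [&& gen G, G \subset F & matchable k' (F :\: G)]]
  else true.

Lemma matchableS k F F' : F \subset F' -> matchable k F -> matchable k F'.
Proof.
elim: k F F' => //= k IH F F' sF /existsP[G /and3P[gG sG mG]].
apply/existsP; exists G; rewrite gG (subset_trans sG sF).
by apply: IH mG; apply: setSD.
Qed.

Lemma matchable_leq j k F : (j <= k)%N -> matchable k F -> matchable j F.
Proof.
elim: k j F => [|k IH] [|j] F //= le_jk /existsP[G /and3P[gG sG mG]].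
by apply/existsP; exists G; rewrite gG sG IH.
Qed.

Lemma matchable_blocks (X : {set 'I_m}) F :
  (forall i, i \in X -> W i \subset F) -> matchable #|X| F.
Proof.
move: {2}#|X| (erefl #|X|) => c; elim: c X F => [|c IH] X F cX sX.
  by rewrite cX.
have /card_gt0P[i iX] : (0 < #|X|)%N by rewrite cX.
have cX' : #|X :\ i| = c by apply/eqP; rewrite -eqSS -cX (cardsD1 i X) iX.
rewrite cX /=; apply/existsP; exists (W i).
rewrite sX // andTb; apply/andP; split.
  by apply/orP; right; apply/existsP; exists i.
rewrite -cX'; apply: IH => // j; rewrite !inE => /andP[ji jX].
by rewrite subsetD sX // disjW.
Qed.

Lemma W_neq0 i : W i != set0.
Proof. by rewrite -card_gt0 cardW; apply: leq_ltn_trans (q_gt (ltn_ord i)). Qed.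

(** X is the set of the blocks used by a choice of k disjoint generators; the
    other k - |X| generators have size b. *)
Lemma matchable_card k F : matchable k F -> exists X : {set 'I_m},
  [/\ (#|X| <= k)%N, forall i, i \in X -> W i \subset F
    & (\sum_(i in X) q i + (k - #|X|) * b <= #|F|)%N].
Proof.
elim: k F => [|k IH] F /=.
  by exists set0; rewrite cards0 big_set0; split=> // i; rewrite inE.
case/existsP=> G /and3P[gG sG /IH[X [cX sX hX]]].
have eF : #|F| = (#|G| + #|F :\: G|)%N by rewrite -(cardsID G F) (setIidPr sG).
case/orP: gG => [/eqP cG|/existsP[i /eqP eG]].
  exists X; split; first exact: leqW.
    by move=> i /sX /subset_trans; apply; apply: subsetDl.
  by rewrite subSn // mulSn eF cG addnCA leq_add2l.
have iX : i \notin X.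
  apply/negP=> /sX; rewrite -eG subsetD => /andP[_].
  by rewrite -setI_eq0 setIid eG (negPf (W_neq0 i)).
exists (i |: X); rewrite cardsU1 iX add1n; split=> //.
  move=> j; rewrite !inE => /predU1P[->|/sX]; first by rewrite -eG.
  by move/subset_trans; apply; apply: subsetDl.
by rewrite big_setU1 //= subSS eF {1}eG cardW -addnA leq_add2l.
Qed.

(** The j-th chosen index is at least j, and q is nondecreasing. *)
Lemma sum_count_le (P : pred nat) p : (p <= m)%N ->
  (\sum_(i < count P (iota 0 p)) q i <= \sum_(i < p | P i) q i)%N.
Proof.
elim: p => [|p IH] le_p; first by rewrite /= !big_ord0.
have -> : count P (iota 0 p.+1) = (count P (iota 0 p) + P p)%N.
  by rewrite -addn1 iotaD count_cat /= addn0.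
rewrite [X in (_ <= X)%N]big_mkcond big_ord_recr /= -big_mkcond /=.
have {}IH := IH (ltnW le_p).
case: (P p); rewrite ?addn0 // addn1 big_ord_recr /= leq_add //.
apply: q_mono => //; apply: leq_trans (count_size _ _) _.
by rewrite size_iota.
Qed.

Lemma sum_card_le (X : {set 'I_m}) :
  (\sum_(i < #|X|) q i <= \sum_(i in X) q i)%N.
Proof.
pose P i := i \in [seq val x | x <- enum X].
have eP (x : 'I_m) : P x = (x \in X).
  by rewrite /P mem_map ?mem_enum //; apply: val_inj.
have := sum_count_le P (leqnn m); rewrite (eq_bigl _ _ eP).
suff -> : count P (iota 0 m) = #|X| by [].
rewrite -val_enum_ord count_map -sum1_count big_enum_cond -sum1_card.
by apply: eq_bigl => x; rewrite /= eP.
Qed.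

(** Replacing blocks by sets of size b only increases the total size. *)
Lemma sum_exchange c k : (c <= k)%N ->
  (\sum_(i < k) q i <= \sum_(i < c) q i + (k - c) * b)%N.
Proof.
elim: k => [|k IH]; first by rewrite leqn0 => /eqP->; rewrite big_ord0.
rewrite leq_eqVlt => /predU1P[->|]; first by rewrite subnn addn0.
rewrite ltnS => le_ck; rewrite big_ord_recr /= subSn // mulSn.
by rewrite addnCA [X in (X <= _)%N]addnC leq_add // IH.
Qed.

Lemma matchable_indeg k F : matchable k F -> (\sum_(i < k) q i <= #|F|)%N.
Proof.
case/matchable_card=> X [cX _]; apply: leq_trans.
by apply: leq_trans (sum_exchange cX) _; rewrite leq_add2r sum_card_le.
Qed.

(** When at most k blocks are available, one of k + 1 disjoint generators has
    size b. *)
Lemma matchable_few_blocks k F (Y : {set 'I_m}) : (#|Y| <= k)%N ->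
    (forall i, W i \subset F -> i \in Y) ->
  matchable k.+1 F -> (\sum_(i < k) q i + b <= #|F|)%N.
Proof.
move=> cY hY /matchable_card[X [_ sX]]; apply: leq_trans.
have cX : (#|X| <= k)%N.
  by apply: leq_trans cY; apply/subset_leq_card/subsetP=> i /sX/hY.
rewrite subSn // mulSn addnCA [X in (X <= _)%N]addnC leq_add2l.
by apply: leq_trans (sum_exchange cX) _; rewrite leq_add2r sum_card_le.
Qed.

(** There are only m blocks, so m + 1 disjoint generators would need more
    elements than the variables available. *)
Lemma matchable_le k F : matchable k F -> (k <= m)%N.
Proof.
move=> hk; rewrite leqNgt; apply/negP=> lt_m.
have := matchable_few_blocks (k := m) (Y := setT) _ (fun _ _ => in_setT _)
  (matchable_leq lt_m hk).
rewrite cardsT card_ord => /(_ (leqnn m)).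
have := max_card (mem F); rewrite card_ord [X in (_ <= X)%N]n_def.
by move: (\sum_(i < m) _)%N #|F| => s f; lia.
Qed.

Lemma card_blocks (X : {set 'I_m}) :
  #|\bigcup_(i in X) W i| = (\sum_(i in X) q i)%N.
Proof.
rewrite (eq_bigr (fun i => #|W i|)) => [|i _]; last by rewrite cardW.
have /eqP : trivIset [set W i | i in X].
  apply/trivIsetP=> _ _ /imsetP[i _ ->] /imsetP[j _ ->] ne.
  by apply: disjW; apply: contraNneq ne => ->.
rewrite cover_imset => <-; rewrite big_imset //= => i j _ _ eW.
apply/eqP; apply: contraT => /disjW.
by rewrite eW -setI_eq0 setIid (negPf (W_neq0 j)).
Qed.

Definition rest := ~: \bigcup_i W i.

Lemma card_rest : #|rest| = b.-1.
Proof.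
have hT : \bigcup_i W i = \bigcup_(i in [set: 'I_m]) W i.
  by apply: eq_bigl => i; rewrite inE.
have cT : #|\bigcup_i W i| = (\sum_(i < m) q i)%N.
  by rewrite hT card_blocks; apply: eq_bigl => i; rewrite inE.
apply: (@addnI #|\bigcup_i W i|).
by rewrite cardsC card_ord {1}n_def cT.
Qed.

Lemma block_rest i : [disjoint W i & rest].
Proof. by rewrite disjoints_subset setCK; apply: bigcup_sup. Qed.

Definition nonmatching k F := ~~ matchable k F.

Lemma nonmatching_down_closed k : down_closed (nonmatching k).
Proof. by move=> A B sAB; apply: contra; apply: matchableS. Qed.

Definition expected_depth k := (\sum_(i < k.-1) q i + b.-1)%N.

Definition initial k : {set 'I_m} := [set i : 'I_m | (i < k)%N].

Lemma sum_initial k : (k <= m)%N ->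
  (\sum_(i in initial k) q i = \sum_(i < k) q i)%N.
Proof.
move=> le_k; rewrite (big_ord_widen m q le_k).
by apply: eq_bigl => i; rewrite inE.
Qed.

Lemma card_initial k : (k <= m)%N -> #|initial k| = k.
Proof.
move=> le_k; rewrite -sum1_card -[RHS]card_ord -sum1_card.
rewrite (big_ord_widen m (fun=> 1%N) le_k).
by apply: eq_bigl => i; rewrite inE.
Qed.

(** A facet of least size among those of the complex of x_F outside I^[k]: adding
    any vertex completes the leftover variables to a further generator of
    size b. *)
Definition small_facet k := (\bigcup_(i in initial k.-1) W i) :|: rest.

Lemma small_facet_blocks k i : W i \subset small_facet k -> i \in initial k.-1.
Proof.
have /set0Pn[x xi] := W_neq0 i; move/subsetP/(_ x xi).
rewrite inE => /orP[/bigcupP[j lt_j xj]|xr].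
  suff -> : i = j by [].
  by apply/eqP; apply: contraT => /disjW/disjointFr/(_ xi); rewrite xj.
by rewrite (disjointFr (block_rest i) xi) in xr.
Qed.

Lemma card_small_facet k : (k <= m)%N -> #|small_facet k| = expected_depth k.
Proof.
move=> le_k; have le_k' := leq_trans (leq_pred k) le_k.
rewrite /small_facet /expected_depth -card_rest -sum_initial // -card_blocks.
have /eqP dB : (\bigcup_(i in initial k.-1) W i) :&: rest == set0.
  rewrite setI_eq0 disjoints_subset setCK; apply/bigcupsP=> i _.
  exact: bigcup_sup.
by rewrite cardsU dB cards0 subn0.
Qed.

Lemma small_facet_nonmatching k : (0 < k)%N -> (k <= m)%N ->
  nonmatching k (small_facet k).
Proof.
case: k => // k _ le_k; apply/negP=> /matchable_few_blocks.
move/(_ (initial k)); rewrite card_initial ?(ltnW le_k) //.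
rewrite card_small_facet // leqnn.
move/(_ isT (@small_facet_blocks k.+1)); rewrite /expected_depth leq_add2l.
by case: (b) b_gt0 => //= c _; rewrite ltnn.
Qed.

Lemma small_facet_maximal k x : (0 < k)%N -> (k <= m)%N ->
  x \notin small_facet k -> ~~ nonmatching k (x |: small_facet k).
Proof.
case: k => // k _ le_k; rewrite inE negb_or => /andP[xB xR]; rewrite negbK /=.
apply/existsP; exists (x |: rest); apply/and3P; split.
- by rewrite /gen cardsU1 xR card_rest add1n prednK ?eqxx.
- by rewrite setUS // subsetUr.
- rewrite -{1}(card_initial (ltnW le_k)); apply: matchable_blocks => i ik.
  have sB : W i \subset \bigcup_(i in initial k) W i by apply: bigcup_sup ik.
  rewrite subsetD (subset_trans sB) /=; last by rewrite setUCA subsetUl.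
  rewrite disjoint_sym disjoint_setU1 disjoint_sym block_rest andbT.
  by apply: contra xB; apply: (subsetP sB).
Qed.

(** The decision tree applies: q_(k-1) > m pays for the deletions, one for each
    block.  Once every block is decided, either k blocks are forced and there is
    no face left, or fewer than k blocks are available and every remaining set
    with at most expected_depth k elements is too small to contain k disjoint
    generators. *)
Lemma nonmatching_regular k : (0 < k)%N -> (k <= m)%N ->
  wregular (nonface_ideal (K := K) (nonmatching k))
    (elementary_seq K n (expected_depth k)).
Proof.
move=> k0 le_k.
have dc : down_closed (nonmatching k) by apply: nonmatching_down_closed.
have : good K (expected_depth k) (nonmatching k) set0 set0.
  apply: (@good_undecided K n m _ _ W) => //; last 2 first.
  - by rewrite disjoints_subset sub0set.
  - rewrite setC0 cardsT card_ord [X in (_ <= X)%N]n_def /expected_depth.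
    rewrite addnA leq_add2r.
    apply: leq_trans (_ : q k.-1 + \sum_(i < k.-1) q i <= _)%N.
      rewrite leq_add2r (leq_trans (max_card _)) // card_ord ltnW // q_gt //.
      by rewrite prednK.
    rewrite addnC -(big_ord_recr k.-1 (fun i => q i)) prednK //.
    rewrite (big_ord_widen m q le_k).
    rewrite [X in (_ <= X)%N](bigID (fun i : 'I_m => (i < k)%N)) /=.
    exact: leq_addr.
  move=> T D dTD u0.
  have [le_kT|lt_T] := leqP k #|[set i | W i \subset T]|.
    left; rewrite negbK; apply: (matchable_leq le_kT).
    by apply: matchable_blocks => i; rewrite inE.
  right=> F sF cF; apply/negP; case: (k) k0 lt_T cF => // k' _ lt_T cF.
  move/(matchable_few_blocks (Y := [set i | W i \subset T]) lt_T).
  move: cF; rewrite /expected_depth /= => cF.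
  have hb : (b.-1 < b)%N by rewrite prednK.
  move=> h; suff : (\sum_(i < k') q i + b <= \sum_(i < k') q i + b.-1)%N.
    by rewrite leq_add2l leqNgt hb.
  apply: leq_trans cF; apply: h => i sW; rewrite inE; apply: contraT => nsW.
  have : i \in undecided W T D.
    by rewrite inE nsW disjoints_subset (subset_trans sW).
  by rewrite u0 inE.
apply: wregular_ext => h; split=> hh u /hh;
  by rewrite /minor setU0 disjoint_sym disjoints_subset sub0set.
Qed.

Local Notation S := {mpoly K[n]}.
Implicit Types (w : 'X_{1..n}) (f : S).

(** * The squarefree powers of the ideal *)

Definition generator u := exists2 A, gen A & u = mesym1 A.

Definition matching_ideal : S -> Prop :=
  ideal_gen (fun f => exists2 u, generator u & f = 'X_[u]).

Local Notation I := matching_ideal.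

Lemma gen_neq0 A : gen A -> A != set0.
Proof.
case/orP=> [/eqP cA|/existsP[i /eqP->]]; last exact: W_neq0.
by rewrite -card_gt0 cA.
Qed.

Lemma matching_idealP f :
  I f <-> monomial_ideal (fun u => exists2 A, gen A & A \subset supp u) f.
Proof.
rewrite /matching_ideal ideal_gen_monomials; split=> h u /h.
  by case=> _ [A gA ->]; rewrite mesym1_le; exists A.
by case=> A gA sA; exists (mesym1 A); [exists A | rewrite mesym1_le].
Qed.

Lemma squarefree_mesym1 A : squarefree (mesym1 A).
Proof. by move=> i; rewrite mnmE leq_b1. Qed.

(** The counterpart of matchable for monomials with exponents: u is divisible by
    a product of k generators. *)
Fixpoint divisible_by_gens k u : Prop :=
  if k is k'.+1 then
    exists A, [/\ gen A, A \subset supp u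
                & divisible_by_gens k' (u - mesym1 A)%MM]
  else True.

Lemma divisible_by_gens_le k u v :
  (u <= v)%MM -> divisible_by_gens k u -> divisible_by_gens k v.
Proof.
elim: k u v => //= k IH u v le_uv [A [gA sA hA]]; exists A; split=> //.
  by apply: subset_trans sA (suppS le_uv).
apply: IH hA; apply/mnm_lepP=> i; rewrite !mnmBE; apply: leq_sub2r.
exact/mnm_lepP.
Qed.

Lemma ideal_pow_divisible k f :
  ideal_pow I k f -> monomial_ideal (divisible_by_gens k) f.
Proof.
apply: ideal_gen_min.
  apply: monomial_ideal_is_ideal => u v; apply: divisible_by_gens_le.
  exact: lem_addr.
move=> _ [g [hg ->]]; elim: k g hg => [|k IH] g hg; first by rewrite big_ord0.
rewrite big_ord_recl => u /msuppM_le/allpairsP[[u1 u2] /= [h1 h2 ->]].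
have /matching_idealP/(_ u1 h1)[A gA sA] := hg ord0.
exists A; split=> //; first by rewrite suppD subsetU // sA.
apply: divisible_by_gens_le (IH (fun i => g (lift ord0 i)) _ u2 h2) => [|i].
  apply/mnm_lepP=> i; rewrite mnmBE mnmDE.
  by rewrite -mesym1_le in sA; move/mnm_lepP/(_ i): sA; lia.
exact: hg.
Qed.

(** Factors of a squarefree monomial have disjoint supports. *)
Lemma divisible_matchable k u : squarefree u ->
  divisible_by_gens k u -> matchable k (supp u).
Proof.
elim: k u => //= k IH u su [A [gA sA hA]]; apply/existsP; exists A.
rewrite gA sA /=; have e : supp (u - mesym1 A) = supp u :\: A.
  apply/setP=> i; rewrite !inE mnmBE mnmE; case: (i \in A); last by rewrite subn0.
  by have := su i; case: (u i) => [|[|]].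
rewrite -e; apply: IH => // i; rewrite mnmBE.
by apply: leq_trans (leq_subr _ _) (su i).
Qed.

Lemma matchable_product k F : matchable k F ->
  exists2 A : {set 'I_n}, A \subset F & exists g : 'I_k -> S,
    (forall i, I (g i)) /\ 'X_[mesym1 A] = \prod_(i < k) g i.
Proof.
elim: k F => [|k IH] F /=.
  exists set0; first exact: sub0set.
  by exists (fun=> 0); split=> [[]//|]; rewrite big_ord0 mesym1_set0 mpolyX0.
case/existsP=> G /and3P[gG sG /IH[A sA [g [hg eA]]]].
exists (G :|: A).
  by rewrite subUset sG (subset_trans sA) // subsetDl.
exists (fun i => if unlift ord0 i is Some j then g j else 'X_[mesym1 G]).
split.
  move=> i; case: unliftP => [j _|_]; first exact: hg.
  by apply/ideal_gen_sub; exists (mesym1 G) => //; exists G.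
rewrite big_ord_recl unlift_none; under eq_bigr do rewrite liftK.
rewrite -eA -mpolyXD; congr 'X_[_]; apply/mnmP=> i; rewrite mnmDE !mnmE inE.
move/subsetP/(_ i): sA; rewrite inE.
by do 2 case: (i \in _) => //; move=> /(_ isT)/andP[].
Qed.

Lemma squarefree_powerP k f :
  squarefree_power I k f <-> nonface_ideal (nonmatching k) f.
Proof.
have iP : is_ideal (squarefree_power I k) by apply: ideal_gen_is_ideal.
have dc : down_closed (nonmatching k) by apply: nonmatching_down_closed.
split.
  apply: ideal_gen_min; first exact: nonface_ideal_is_ideal.
  move=> _ [u [su hu ->]]; apply/monomial_idealX; rewrite negbK.
  apply: divisible_matchable => //.
  by move/ideal_pow_divisible/monomial_idealX: hu.
move: f; apply: monomial_ideal_sub => // u; rewrite negbK.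
case/matchable_product=> A sA [g [hg eA]].
rewrite -(submK (m := mesym1 A) (m' := u)) ?mesym1_le // mpolyXD.
apply: idealMl => //; apply: ideal_gen_sub; exists (mesym1 A); split=> //.
  exact: squarefree_mesym1.
by apply: ideal_gen_sub; exists g.
Qed.

Lemma squarefree_powerX k u :
  squarefree_power I k 'X_[u] <-> matchable k (supp u).
Proof. by rewrite squarefree_powerP /nonface_ideal monomial_idealX negbK. Qed.

(** The minimum is attained by the product of the k smallest block monomials. *)
Lemma indeg_squarefree_power k : (k <= m)%N ->
  is_indeg (squarefree_power I k) (\sum_(i < k) q i).
Proof.
move=> le_k; pose B := \bigcup_(i in initial k) W i.
have cB : #|B| = (\sum_(i < k) q i)%N.
  by rewrite card_blocks sum_initial.
split; last first.
  move=> u [/squarefree_powerX/matchable_indeg hu _].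
  by apply: leq_trans hu (card_supp u).
exists (mesym1 B); last by rewrite mdeg_mesym1.
split.
  apply/squarefree_powerX; rewrite supp_mesym1 -(card_initial le_k).
  by apply: matchable_blocks => i hi; apply: bigcup_sup hi.
move=> v /squarefree_powerX/matchable_indeg hv le_v.
have dv : (mdeg (mesym1 B) <= mdeg v)%N.
  by rewrite mdeg_mesym1 cB (leq_trans hv) // card_supp.
move: dv; rewrite -{1}(submK le_v) mdegD -{2}[mdeg v]add0n leq_add2r.
rewrite leqn0 mdeg_eq0.
by move/eqP=> e0; rewrite -(submK le_v) e0 add0m.
Qed.

Lemma nonmatching_monomials k f : (0 < k)%N ->
  nonface_ideal (nonmatching k) f ->
  monomial_ideal (fun u => 0 < mdeg u)%N f.
Proof.
case: k => // k _ hf u /hf; rewrite negbK lt0n mdeg_eq0 => hu.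
apply: contraTneq hu => ->.
rewrite supp0; apply/negP=> /existsP[G /and3P[gG]]; rewrite subset0 => sG.
by rewrite (negPf (gen_neq0 gG)) in sG.
Qed.

(** The elementary symmetric polynomials attain the depth, and the small facet
    bounds it. *)
Lemma depth_squarefree_power k : (0 < k)%N -> (k <= m)%N ->
  is_depth (squarefree_power I k) (expected_depth k).
Proof.
move=> k0 le_k.
have dc : down_closed (nonmatching k) by apply: nonmatching_down_closed.
have iP : is_ideal (squarefree_power I k) by apply: ideal_gen_is_ideal.
split.
  exists (elementary_seq K n (expected_depth k)).
  have homog_pos f : f \in elementary_seq K n (expected_depth k) ->
      monomial_ideal (fun u => 0 < mdeg u)%N f.
    case/mapP=> i _ -> u; by rewrite mem_msupp_mesym => /andP[/eqP->].
  split.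
  - by rewrite size_map size_iota.
  - by move=> f /homog_pos/max_ideal_monomials.
  apply/regular_seqP => //; split.
    apply: wregular_ext (nonmatching_regular k0 le_k).
    by move=> h; rewrite squarefree_powerP.
  move/(add_seq_min (C := monomial_ideal (fun u => 0 < mdeg u)%N)) => h.
  have /(_ 0%MM) :
      monomial_ideal (K := K) (n := n) (fun u => 0 < mdeg u)%N 1.
    apply: h => //.
      by apply: monomial_ideal_is_ideal => u v h; rewrite mdegD ltn_addr.
    by move=> x /squarefree_powerP; apply: nonmatching_monomials.
  by rewrite msupp1 mem_head mdeg0 => /(_ isT).
move=> _ [s [<- hs /regular_seqP[] // rs _]].
rewrite -(card_small_facet le_k).
apply: (depth_le_facet (K := K) dc (s := s)).
- exact: small_facet_nonmatching.
- by move=> x; apply: small_facet_maximal.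
- by move=> f /hs/max_ideal_monomials.
- by apply: wregular_ext rs => h; rewrite squarefree_powerP.
Qed.

Lemma matching_idealX u :
  I 'X_[u] <-> exists2 A, gen A & A \subset supp u.
Proof. by rewrite matching_idealP monomial_idealX. Qed.

Lemma matchable_coprime us F : (forall u, u \in us -> I 'X_[u]) ->
    (forall u, u \in us -> supp u \subset F) -> pairwise (@coprime_supp n) us ->
  matchable (size us) F.
Proof.
elim: us F => //= u us IH F hI hF /andP[/allP cu pw].
have /matching_idealX[A gA sA] := hI u (mem_head _ _).
apply/existsP; exists A; rewrite gA (subset_trans sA) ?hF ?mem_head //=.
apply: IH => // v vus; first by apply: hI; rewrite inE vus orbT.
rewrite subsetD hF ?inE ?vus ?orbT //=.
by apply: disjointWr sA _; rewrite disjoint_sym; apply: cu.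
Qed.

Lemma grade_matching_ideal : is_monomial_grade I m.
Proof.
split.
  exists [seq mesym1 (W i) | i <- enum 'I_m]; split.
  - by rewrite size_map size_enum_ord.
  - move=> _ /mapP[i _ ->]; apply/matching_idealX; exists (W i).
      by apply/orP; right; apply/existsP; exists i.
    by rewrite supp_mesym1.
  apply/regular_seqP; first exact: zero_ideal.
  apply/regular_monomials; split.
    rewrite pairwise_map; have := enum_uniq 'I_m; rewrite uniq_pairwise.
    by apply: sub_pairwise => i j /= /disjW; rewrite /coprime_supp !supp_mesym1.
  apply/negP=> /mapP[i _ /(congr1 (@supp n))].
  rewrite supp0 supp_mesym1 => /esym/eqP.
  by rewrite (negPf (W_neq0 i)).
move=> _ [us [<- hI /regular_seqP[]]]; first exact: zero_ideal.
move=> rs n1; have /regular_monomials[pw _] := conj rs n1.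
apply: (matchable_le (F := setT)).
by apply: matchable_coprime => // u _; apply: subsetT.
Qed.

Lemma min_gen_mesym1 A : gen A -> (forall G, gen G -> G \subset A -> G = A) ->
  min_gen I (mesym1 A).
Proof.
move=> gA hA; split; first by apply/matching_idealX; exists A; rewrite ?supp_mesym1.
move=> v /matching_idealX[G gG sG] le_v.
have sGA : G \subset A by rewrite -[A]supp_mesym1 (subset_trans sG) // suppS.
have {}sG : A \subset supp v by rewrite -(hA G gG sGA).
apply/mnmP=> i; apply/eqP; rewrite eqn_leq (mnm_lepP le_v) /=.
by move: sG; rewrite -mesym1_le => /mnm_lepP.
Qed.

(** A variable outside the blocks occurs in the monomial of all those variables
    and one vertex y of a block; this has degree b and contains no block, because
    blocks have more than one element. *)
Lemma all_vars_matching_ideal : (0 < m)%N -> all_vars_used I.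
Proof.
move=> m_gt0.
have block_gen i : gen (W i) by apply/orP; right; apply/existsP; exists i.
move=> x; have [/bigcupP[i _ xi]|xr] := boolP (x \in \bigcup_i W i).
  exists (mesym1 (W i)); last by rewrite mnmE xi.
  apply: min_gen_mesym1 => // G /orP[/eqP cG|/existsP[j /eqP->]] sG.
    by apply/eqP; rewrite eqEcard sG cG cardW q_le.
  suff -> : j = i by [].
  apply/eqP; apply: contraT => /disjW; have /set0Pn[y yj] := W_neq0 j.
  by move/disjointFr/(_ yj); rewrite (subsetP sG).
pose i0 := Ordinal m_gt0; have /set0Pn[y yi] := W_neq0 i0.
have yr : y \notin rest by rewrite inE negbK; apply/bigcupP; exists i0.
have cA : #|y |: rest| = b.
  by rewrite cardsU1 yr card_rest add1n prednK.
exists (mesym1 (y |: rest)); last by rewrite mnmE !inE xr orbT.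
apply: min_gen_mesym1 => [|G]; first by rewrite /gen cA eqxx.
case/orP=> [/eqP cG|/existsP[j /eqP->]] sG.
  by apply/eqP; rewrite eqEcard sG cG cA leqnn.
have : W j \subset [set y].
  apply/subsetP=> z zj; have := subsetP sG z zj; rewrite !inE => /orP[//|].
  by move=> h; case/negP: h; apply/bigcupP; exists j.
move/subset_leq_card; rewrite cards1 cardW leqNgt.
by rewrite (leq_ltn_trans m_gt0 (q_gt (ltn_ord j))).
Qed.

Lemma nonzero_proper_matching_ideal : (0 < m)%N -> nonzero_proper I.
Proof.
move=> m_gt0; split.
  exists 'X_[mesym1 (W (Ordinal m_gt0))].
    apply/matching_idealX; exists (W (Ordinal m_gt0)); last by rewrite supp_mesym1.
    by apply/orP; right; apply/existsP; exists (Ordinal m_gt0).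
  by apply/eqP; rewrite -msupp_eq0 msuppX.
move/matching_idealP/(_ 0%MM); rewrite msupp1 mem_head => /(_ isT)[A gA].
by rewrite supp0 subset0 (negPf (gen_neq0 gA)).
Qed.

Lemma squarefree_matching_ideal : squarefree_monomial_ideal I.
Proof.
exists generator; split=> [_ [A _ ->]|f]; first exact: squarefree_mesym1.
by [].
Qed.

Lemma normalized_depth_matching_ideal k : (0 < k)%N -> (k <= m)%N ->
  is_normalized_depth I k (b - q k.-1)%N%:Z.
Proof.
move=> k0 le_k; exists (expected_depth k), (\sum_(i < k) q i)%N; split.
- exact: depth_squarefree_power.
- exact: indeg_squarefree_power.
case: k k0 {le_k} => // k _; rewrite /expected_depth big_ord_recr /=.
have := q_le k; move: (\sum_(i < k) q i)%N (q k) b_gt0 => s p; lia.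
Qed.

End Blocks.

(** * Realizing a non-increasing sequence *)

Lemma card_ord_interval n l h : (l <= h)%N -> (h <= n)%N ->
  #|[set x : 'I_n | (l <= x < h)%N]| = (h - l)%N.
Proof.
move=> le_lh le_hn; rewrite -sum1_card.
rewrite (eq_bigl (fun x : 'I_n => (l <= x < h)%N)) => [|x]; last by rewrite inE.
rewrite -(big_mkord (fun x => (l <= x < h)%N) (fun=> 1%N)).
by rewrite -[RHS]muln1 -sum_nat_const_nat (big_nat_widenl l 0) //
  (big_nat_widen 0 h n).
Qed.

Theorem theorem4p1 (K : fieldType) (m : nat) (hm : (1 <= m)%N) (a : nat -> nat)
  (ha : forall i j : nat, (1 <= i)%N -> (i <= j)%N -> (j <= m)%N ->
        (a j <= a i)%N) :
  exists (n : nat) (I : {mpoly K[n]} -> Prop),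
    [/\ squarefree_monomial_ideal I,
        nonzero_proper I,
        all_vars_used I,
        is_monomial_grade I m
      & forall k : nat, (1 <= k)%N -> (k <= m)%N ->
          is_normalized_depth I k (a k)%:Z].
Proof.
(* Any larger b would do; this one gives q i > m for i < m, which leaves room
   for the deletions in the decision tree. *)
pose b := (a 1%N + m.+1)%N; pose q i := (b - a i.+1)%N.
pose Q i := (\sum_(j < i) q j)%N; pose n := (Q m + b.-1)%N.
pose W (i : 'I_m) := [set x : 'I_n | (Q i <= x < Q i.+1)%N].
have a_le i : (i < m)%N -> (a i.+1 <= a 1%N)%N by move=> lt_i; apply: ha.
have b_gt0 : (0 < b)%N by rewrite /b addnS.
have q_le i : (q i <= b)%N by apply: leq_subr.
have q_mono i j : (i <= j)%N -> (j < m)%N -> (q i <= q j)%N.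
  by move=> le_ij lt_j; apply: leq_sub2l; apply: ha.
have q_gt i : (i < m)%N -> (m < q i)%N.
  by move/a_le; rewrite /q /b; lia.
have Q_mono i j : (i <= j)%N -> (Q i <= Q j)%N.
  move=> le_ij; rewrite -(subnKC le_ij) /Q big_split_ord /=; exact: leq_addr.
have cardW i : #|W i| = q i.
  rewrite card_ord_interval ?Q_mono //; first by rewrite /Q big_ord_recr addKn.
  by apply: leq_trans (leq_addr _ _); apply: Q_mono.
have disjW i j : i != j -> [disjoint W i & W j].
  rewrite -setI_eq0 => ne; apply/set0Pn=> -[x]; rewrite !inE.
  case/andP=> /andP[x1 x2] /andP[x3 x4]; move: ne; rewrite -val_eqE /= neq_ltn.
  by case/orP=> /Q_mono h; lia.
exists n, (@matching_ideal K n m b W); split.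
- exact: squarefree_matching_ideal.
- exact: (nonzero_proper_matching_ideal K b_gt0 q_gt cardW hm).
- exact: (all_vars_matching_ideal K b_gt0 q_le q_gt cardW disjW (erefl n) hm).
- exact: (grade_matching_ideal K b_gt0 q_le q_mono q_gt cardW disjW (erefl n)).
move=> k k0 le_k.
have -> : a k = (b - q k.-1)%N.
  rewrite /q prednK // subKn // /b.
  by apply: leq_trans (ha 1%N k _ _ _) _ => //; apply: leq_addr.
exact: (normalized_depth_matching_ideal K b_gt0 q_le q_mono q_gt cardW disjW
  (erefl n)).
Qed.
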